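(* For every $m\ge 1$ the cohomology group $H^m(G,M^\times)=Z^m(G,M^\times)/B^m(G,M^\times)$ of $G=PGL(3,\mathbb{R})$ is trivial: $$H^m(G,M^\times)=1,\qquad m\ge1.$$
   Context: Fix $n\ge3$. Let $\mathcal{M}=(J^1(\mathbb{R}^2,\mathbb{R}))^n\cong(\mathbb{R}^2\times\mathbb{R}^2)^n$ be the $n$-fold first-order jet space, with coordinates $\boldsymbol{x}=(x_i,y_i,p_i,q_i)_{i=1}^n$, where $p_i=\partial_xu(x_i,y_i)$ and $q_i=\partial_yu(x_i,y_i)$ for a smooth function $u:\mathbb{R}^2\to\mathbb{R}$. The group $G=PGL(3,\mathbb{R})$ acts on $\mathcal{M}$, $(g,\boldsymbol{x})\mapsto g\cdot\boldsymbol{x}$, with $g_1\cdot(g_2\cdot\boldsymbol{x})=(g_1g_2)\cdot\boldsymbol{x}$: for $g$ represented by the matrix with rows $(a_1,a_2,a_3)$, $(b_1,b_2,b_3)$, $(c_1,c_2,c_3)$, normalized by $c_3=1$, each point is transformed by $$\widetilde x_i=\frac{a_1x_i+a_2y_i+a_3}{c_1x_i+c_2y_i+1},\qquad \widetilde y_i=\frac{b_1x_i+b_2y_i+b_3}{c_1x_i+c_2y_i+1},$$ and the derivatives $(p_i,q_i)$ are transformed by the first prolongation, i.e. $p_i=\widetilde p_i\,\partial_x\widetilde x+\widetilde q_i\,\partial_x\widetilde y$, $q_i=\widetilde p_i\,\partial_y\widetilde x+\widetilde q_i\,\partial_y\widetilde y$, with the partial derivatives of the projective map evaluated at $(x_i,y_i)$.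 Moving frame: the action is considered together with the global right moving frame $\rho:\mathcal{M}\to G$, $\rho(g\cdot\boldsymbol{x})=\rho(\boldsymbol{x})g^{-1}$, obtained by solving $\rho(\boldsymbol{x})\cdot\boldsymbol{x}\in\mathcal{K}$ for the cross-section $\mathcal{K}=\{x_1=1,\ x_2=0,\ x_3=0,\ y_1=0,\ y_2=0,\ y_3=1,\ p_1=1,\ q_1=0\}$. Cochains: let $\mathbb{R}^\times=\mathbb{R}\setminus\{0\}$, and let $M^\times=\operatorname{Map}(\mathcal{M},\mathbb{R}^\times)$ be the multiplicative abelian group (under pointwise multiplication) of all nonzero rational functions on $\mathcal{M}$. The multiplicative cochain complex with coefficients in $M^\times$ has $C^m=\operatorname{Map}(G^m\times\mathcal{M},\mathbb{R}^\times)$ for $m\ge0$ (so $C^0=M^\times$), with differentials $d^m:C^m\to C^{m+1}$ given by $(d^0c)(g,\boldsymbol{x})=c(g\cdot\boldsymbol{x})/c(\boldsymbol{x})$ and, for $m\ge1$, $$(d^mc)(g_1,\dots,g_{m+1};\boldsymbol{x})=c(g_2,\dots,g_{m+1};\boldsymbol{x})\cdot\prod_{i=1}^m c(g_1,\dots,g_ig_{i+1},\dots,g_{m+1};\boldsymbol{x})^{(-1)^i}\cdot c(g_1,\dots,g_m;g_{m+1}\cdot\boldsymbol{x})^{(-1)^{m+1}}.$$ Put $Z^m(G,M^\times)=\ker d^m$ and $B^m(G,M^\times)=\operatorname{Im}d^{m-1}$. *)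

(* Defs.v *)
From HB Require Import structures.
From mathcomp Require Import -(notations) mpoly.
From mathcomp Require Import all_boot all_order all_algebra generic_quotient.
From mathcomp Require Import boolp classical_sets reals.
From mathcomp Require Import topology normedtype derive.

Set Implicit Arguments.
Unset Strict Implicit.
Unset Printing Implicit Defensive.

Import Order.TTheory GRing.Theory Num.Theory numFieldNormedType.Exports.
Local Open Scope classical_set_scope.
Local Open Scope ring_scope.
Local Open Scope quotient_scope.

Section ProjectiveGroup.
Variable R : realType.

Definition gl3 := {A : 'M[R]_3 | A \in unitmx}.

Definition gl3_mul (A B : gl3) : gl3 :=
  exist _ (val A *m val B)
    (etrans (unitmx_mul _ _) (introT andP (conj (valP A) (valP B)))).

Definition gl3_one : gl3 := exist _ 1%:M (unitmx1 _ _).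

Definition gl3_inv (A : gl3) : gl3 :=
  exist _ (invmx (val A)) (etrans (unitmx_inv _) (valP A)).

Definition proportional (A B : gl3) : bool :=
  `[< exists2 k : R, k != 0 & val A = k *: val B >].

Lemma proportional_refl : reflexive proportional.
Proof. by move=> A; apply/asboolP; exists 1; rewrite ?oner_neq0 ?scale1r. Qed.

Lemma proportional_sym : symmetric proportional.
Proof.
suff H A B : proportional A B -> proportional B A.
  by move=> A B; apply/idP/idP; apply: H.
move=> /asboolP[k k0 AB]; apply/asboolP; exists k^-1; rewrite ?invr_eq0 //.
by rewrite AB scalerA mulVf // scale1r.
Qed.

Lemma proportional_trans : transitive proportional.
Proof.
move=> B A C /asboolP[k k0 AB] /asboolP[l l0 BC]; apply/asboolP.
by exists (k * l); rewrite ?mulf_neq0 // AB BC scalerA.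
Qed.

Canonical proportional_equiv :=
  EquivRel proportional proportional_refl proportional_sym proportional_trans.

Definition pgl3 := {eq_quot proportional}.
HB.instance Definition _ := Choice.on pgl3.
HB.instance Definition _ := EqQuotient.on pgl3.

Definition pgl3_mul (g h : pgl3) : pgl3 := \pi_pgl3 (gl3_mul (repr g) (repr h)).
Definition pgl3_one : pgl3 := \pi gl3_one.
Definition pgl3_inv (g : pgl3) : pgl3 := \pi_pgl3 (gl3_inv (repr g)).

Lemma pi_proportional (A B : gl3) :
  (\pi_pgl3 A = \pi_pgl3 B) <-> exists2 k : R, k != 0 & val A = k *: val B.
Proof.
split=> [/eqmodP /asboolP //|H].
by apply/eqmodP/asboolP.
Qed.

Lemma repr_proportional (A : gl3) :
  exists2 k : R, k != 0 & val (repr (\pi_pgl3 A)) = k *: val A.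
Proof. by apply/pi_proportional; rewrite reprK. Qed.

Lemma pgl3_mulE (A B : gl3) : pgl3_mul (\pi_pgl3 A) (\pi_pgl3 B) = \pi_pgl3 (gl3_mul A B).
Proof.
apply/pi_proportional => /=.
have [k k0 ->] := repr_proportional A; have [l l0 ->] := repr_proportional B.
by exists (k * l); rewrite ?mulf_neq0 // -scalemxAl -scalemxAr scalerA.
Qed.

Lemma pgl3_mulA : associative pgl3_mul.
Proof.
elim/quotW=> A; elim/quotW=> B; elim/quotW=> C.
rewrite (pgl3_mulE B C) (pgl3_mulE A B) (pgl3_mulE A) (pgl3_mulE _ C).
by apply: (congr1 \pi_pgl3); apply: val_inj; rewrite /= mulmxA.
Qed.

Lemma pgl3_mul1 : left_id pgl3_one pgl3_mul.
Proof.
elim/quotW=> A; rewrite pgl3_mulE.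
by apply: (congr1 \pi_pgl3); apply: val_inj; rewrite /= mul1mx.
Qed.

Lemma pgl3_mulr1 : right_id pgl3_one pgl3_mul.
Proof.
elim/quotW=> A; rewrite pgl3_mulE.
by apply: (congr1 \pi_pgl3); apply: val_inj; rewrite /= mulmx1.
Qed.

Lemma pgl3_mulV : left_inverse pgl3_one pgl3_inv pgl3_mul.
Proof.
move=> g; rewrite -{2}[g]reprK (pgl3_mulE _ (repr g)).
by apply: (congr1 \pi_pgl3); apply: val_inj; rewrite /= mulVmx //;
  apply: (valP (repr g)).
Qed.

Lemma pgl3_mulrV : right_inverse pgl3_one pgl3_inv pgl3_mul.
Proof.
move=> g; rewrite -{1}[g]reprK pgl3_mulE.
by apply: (congr1 \pi_pgl3); apply: val_inj; rewrite /= mulmxV //;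
  apply: (valP (repr g)).
Qed.

HB.instance Definition _ := isGroup.Build pgl3
  pgl3_mulA pgl3_mul1 pgl3_mulr1 pgl3_mulV pgl3_mulrV.

(* Entry (i, j) of an arbitrary representative of g: only degree-0 homogeneous
   expressions in these entries are functions on PGL(3, R). *)
Definition entry (g : pgl3) (i j : 'I_3) : R := val (repr g) i j.

Definition proj_den (g : pgl3) (x y : R) : R :=
  entry g 2 0 * x + entry g 2 1 * y + entry g 2 2.

Definition proj_x (g : pgl3) (x y : R) : R :=
  (entry g 0 0 * x + entry g 0 1 * y + entry g 0 2) / proj_den g x y.

Definition proj_y (g : pgl3) (x y : R) : R :=
  (entry g 1 0 * x + entry g 1 1 * y + entry g 1 2) / proj_den g x y.

Definition proj_jacobian (g : pgl3) (x y : R) : 'M[R]_2 :=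
  \matrix_(i < 2, j < 2)
    let f := if i == 0 then proj_x g else proj_y g in
    if j == 0 then derive1 (fun s => f s y) x else derive1 (fun s => f x s) y.

Record jet := Jet { jx : R; jy : R; jp : R; jq : R }.

(* The first prolongation: (p, q) = (p~, q~) J solved for (p~, q~), where J is
   the Jacobian matrix.  The action is only partially defined; where
   [proj_den g x y] vanishes, the value is meaningless. *)
Definition act1 (g : pgl3) (z : jet) : jet :=
  let pq : 'rV[R]_2 := \row_j (if j == 0 then jp z else jq z) in
  let pq' := pq *m invmx (proj_jacobian g (jx z) (jy z)) in
  Jet (proj_x g (jx z) (jy z)) (proj_y g (jx z) (jy z)) (pq' 0 0) (pq' 0 1).

End ProjectiveGroup.

Section Cochains.
Variables (R : realType) (n : nat).
Implicit Types m : nat.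

Definition jets := 'I_n -> jet R.

Definition act (g : pgl3 R) (x : jets) : jets := fun i => act1 g (x i).

Definition space m := (('I_m -> pgl3 R) * jets)%type.

(* The affine coordinates of PGL(3, R)^m x jets: the eight entries other than
   c_3 of each matrix normalized by c_3 = 1, and x_i, y_i, p_i, q_i. *)
Definition entry_index := {k : 'I_3 * 'I_3 | k != (2, 2)}.
Definition coord_index m := (('I_m * entry_index) + ('I_n * 'I_4))%type.

Definition coord m (z : space m) (k : coord_index m) : R :=
  match k with
  | inl (i, k) => entry (z.1 i) (val k).1 (val k).2 / entry (z.1 i) 2 2
  | inr (i, j) => nth 0 [:: jx (z.2 i); jy (z.2 i); jp (z.2 i); jq (z.2 i)] j
  end.

Definition coord_poly m := mpoly #|{: coord_index m}| R.

Definition eval_coord m (P : coord_poly m) (z : space m) : R :=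
  meval (fun k => coord z (enum_val k)) P.

Definition in_chart m (z : space m) : Prop := forall i, entry (z.1 i) 2 2 != 0.

(* S holds on a nonempty, hence dense, Zariski open subset (the chart where all
   c_3 are nonzero is itself open and dense). *)
Definition generically m (S : space m -> Prop) : Prop :=
  exists2 D : coord_poly m, D != 0 &
    forall z, in_chart z -> eval_coord D z != 0 -> S z.

Definition map_space m := space m -> R.

Definition same_rational m (c c' : map_space m) : Prop :=
  generically (fun z => c z = c' z).

(* A nonzero rational function on PGL(3, R)^m x jets is represented by the
   maps into R \ {0} that agree with it on a nonempty Zariski open subset; two
   such maps represent the same rational function iff [same_rational] holds.
   Identities between cochains are therefore meant up to [same_rational]. *)
Definition cochains m : set (map_space m) :=
  [set c | (forall z, c z != 0) /\
     exists P Q : coord_poly m, [/\ P != 0, Q != 0 &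
       same_rational c (fun z => eval_coord P z / eval_coord Q z)]].

(* (g_1, ..., g_i g_{i+1}, ..., g_{m+1}), with i = k + 1. *)
Definition merge_at m (g : 'I_m.+1 -> pgl3 R) (k : 'I_m) : 'I_m -> pgl3 R :=
  fun j => let gj := g (widen_ord (leqnSn m) j) in
           let gj' := g (lift ord0 j) in
           if (j < k)%N then gj else if j == k then (gj * gj')%g else gj'.

Definition differential m (c : map_space m) : map_space m.+1 := fun z =>
  let: (g, x) := z in
  let first := (fun j => g (widen_ord (leqnSn m) j)) : 'I_m -> pgl3 R in
  let rest := (fun j => g (lift ord0 j)) : 'I_m -> pgl3 R in
  let gx := act (g ord_max) x in
  if m is 0 then c (first, gx) / c (rest, x)
  else c (rest, x)
       * (\prod_(k < m) c (merge_at g k, x) ^ ((-1) ^+ k.+1 : int))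
       * c (first, gx) ^ ((-1) ^+ m.+1 : int).

Definition cocycles m : set (map_space m) :=
  [set c | cochains c /\ same_rational (differential c) (fun=> 1)].

(* By convention B^0 = 1. *)
Definition coboundaries m : set (map_space m) :=
  match m return set (map_space m) with
  | 0 => [set c | cochains c /\ same_rational c (fun=> 1)]
  | k.+1 => [set c | cochains c /\
              exists2 b, cochains b & same_rational c (differential b)]
  end.

Definition boundary_coset m (c : map_space m) : set (map_space m) :=
  [set (fun z => c z * b z) | b in @coboundaries m].

(* Z^m / B^m as a set of cosets; its neutral element is the coset B^m. *)
Definition cohomology m : set (set (map_space m)) :=
  [set boundary_coset c | c in @cocycles m].

End Cochains.

(* Main.v *)
Require Import Defs.
From mathcomp Require Import all_boot all_algebra classical_sets reals.
From mathcomp Require Import -(notations) mpoly.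
From mathcomp Require Import all_order generic_quotient.
From mathcomp Require Import boolp functions topology normedtype derive.
From mathcomp Require Import ring.
Import Defs.

Set Implicit Arguments.
Unset Strict Implicit.
Unset Printing Implicit Defensive.

Import Order.TTheory GRing.Theory Num.Theory numFieldNormedType.Exports.
Local Open Scope ring_scope.

(** A right moving frame contracts the complex.  Suppose that [s] sends a
    configuration [x] of jets to a group element with [s (g x) = g s(x)], and
    put [w x = s(x)^-1 x], which is then invariant.  Evaluating the cocycle
    identity of [c] at [(g_1, ..., g_m, s x; w x)] gives
    [db (g; x) * c (g; x) ^ (+-1) = 1] for
    [b (g; x) = c (g_1, ..., g_(m-1), s x; w x)], hence [c] is a coboundary
    ([bar_product_slice], [cocycle_coboundary]).

    The frame used here is that of three homogeneous points [P_0, P_1, P_2] and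
    the linear form [l] that extends the covector [(p_0, q_0)] and vanishes at
    [P_0]: the matrix with columns [l(P_1) l(P_2) P_0], [l(P_2) P_1], [l(P_1) P_2] is polynomial in the
    jets, and [g] multiplies it on the left by the matrix of [g], up to a
    nonzero scalar ([frame_mx_act]).

    The map [(g; x) |-> (g, s x; w x)] is not dominant, because [w] takes values
    in a slice of the action, and a rational cochain may be undefined, or the
    cocycle identity meaningless, all along a given slice.  So the slice is
    moved: [s x] is the frame of [x] times the inverse frame of a fixed
    configuration [x0], and a point [(g_1, ..., g_(m+1); x0)] is taken at which
    all finitely many generic properties of [c] hold ([generically_point]).
    At [x1 = g_(m+1) x0] the frame is normalized so that [s x1 = g_(m+1)] and
    [w x1 = x0]: the map sends [(g_1, ..., g_m; x1)] to the chosen good point.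
    Since it is given by rational functions regular there ([regular_slice]),
    Zariski neighbourhoods of the good point pull back to Zariski
    neighbourhoods ([zariski_near_pullback]), and these are dense. *)

(** * Polynomials over an infinite domain have nonroots *)

Section PolynomialNonvanishing.
Variable F : numDomainType.

Lemma poly_nonroot (p : {poly F}) : p != 0 -> exists t, p.[t] != 0.
Proof.
move=> p0; pose s : seq F := [seq i%:R | i <- iota 0 (size p)].
have us : uniq s.
  by rewrite map_inj_uniq ?iota_uniq // => i j /eqP; rewrite eqr_nat => /eqP.
have [rs|] := boolP (all (root p) s).
  by have := max_poly_roots p0 rs us; rewrite size_map size_iota ltnn.
by case/allPn => t _ pt; exists t.
Qed.

(** A monomial in [n + 1] variables is determined by its part in the first [n]
    variables and its degree in the last one, so no two terms of [p] can cancel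
    when [p] is read as a polynomial in the last variable. *)
Lemma muni_eq0 n (p : mpoly n.+1 F) : muni p = 0 -> p = 0.
Proof.
move=> p0; apply/mpolyP => m; rewrite mcoeff0.
have [mp|/memN_msupp_eq0//] := boolP (m \in msupp p).
pose h (m : multinom n.+1) := Multinom [tuple m (widen_ord (leqnSn n) i) | i < n].
have E (m' : multinom n.+1) :
    mcoeff (h m) (mcoeff m' p *: mpolyX F (h m') *: 'X^(m' ord_max))`_(m ord_max)
  = mcoeff m' p *+ (m' == m).
  rewrite coefZ coefXn mulr_natr mcoeffMn mcoeffZ mcoeffX mulr_natr -mulrnA.
  rewrite mulnb; congr (_ *+ nat_of_bool _).
  apply/andP/eqP => [[/eqP /mnmP hm /eqP lm]|->]; last by rewrite !eqxx.
  apply/mnmP => i; case: (unliftP ord_max i) => [j|] ->; last exact/esym.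
  have -> : lift ord_max j = widen_ord (leqnSn n) j by exact/val_inj/lift_max.
  by have := hm j; rewrite !mnmE.
have := congr1 (fun q : {poly mpoly n F} => mcoeff (h m) q`_(m ord_max)) p0.
rewrite muniE coef_sum raddf_sum /= coef0 mcoeff0 => {1}<-.
rewrite (bigD1_seq m) ?msupp_uniq //= E eqxx big1 ?addr0 // => m' /negbTE mm'.
by rewrite E mm'.
Qed.

Lemma meval_muni n (p : mpoly n.+1 F) (v : 'I_n -> F) (t : F) :
  (map_poly (meval v) (muni p)).[t] =
  meval (fun i => if unlift ord_max i is Some j then v j else t) p.
Proof.
rewrite muniE raddf_sum /= horner_sum mevalE; apply: eq_bigr => m _.
rewrite map_polyZ map_polyXn hornerZ hornerXn /= (mevalZ v (mcoeff m p)).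
rewrite mevalX -mulrA.
rewrite big_ord_recr /= unlift_none; congr (_ * (_ * _)).
apply: eq_bigr => i _; rewrite mnmE.
have -> : widen_ord (leqnSn n) i = lift ord_max i by exact/val_inj/esym/lift_max.
by rewrite liftK.
Qed.

(** By induction the leading coefficient in the last variable has a nonroot; the
    univariate polynomial obtained by specializing there is nonzero. *)
Lemma mpoly_nonroot n (p : mpoly n F) : p != 0 -> exists v, meval v p != 0.
Proof.
elim: n => [|n IHn] in p *.
  rewrite (nvar0_mpolyC p) => p0; exists (fun=> 0); rewrite mevalC.
  by apply: contra_neq p0 => ->; rewrite mpolyC0.
move=> p0; have : lead_coef (muni p) != 0.
  by rewrite lead_coef_eq0; apply: contra_neq p0 => /muni_eq0.
case/IHn => v pv; have /poly_nonroot[t pt] : map_poly (meval v) (muni p) != 0.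
  apply: contra_neq pv => /(congr1 (fun q : {poly F} => q`_(size (muni p)).-1)).
  by rewrite coef_map coef0.
by rewrite meval_muni in pt; eexists; exact: pt.
Qed.

End PolynomialNonvanishing.

(** * Zariski neighbourhoods and rational functions regular at a point *)

Section LocalRational.
Variables (R : realType) (n m : nat) (z0 : space R n m).
Implicit Types (P Q D : coord_poly R n m) (z : space R n m).

(** Only points of the chart are tested, as in [generically]: the basic open
    sets are those where [D] is nonzero, intersected with the chart. *)
Definition zariski_near (S : space R n m -> Prop) : Prop :=
  exists2 D, eval_coord D z0 != 0 &
    forall z, in_chart z -> eval_coord D z != 0 -> S z.

Lemma zariski_near_imp (S T : space R n m -> Prop) :
  zariski_near S -> (forall z, in_chart z -> S z -> T z) -> zariski_near T.
Proof.
by case=> D D0 DS ST; exists D => // z zc Dz; apply: ST => //; apply: DS.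
Qed.

Lemma zariski_near_true (S : space R n m -> Prop) :
  (forall z, in_chart z -> S z) -> zariski_near S.
Proof.
by move=> HS; exists 1 => [|z zc _]; [rewrite /eval_coord meval1 oner_neq0|apply: HS].
Qed.

Lemma zariski_near_and (S T : space R n m -> Prop) :
  zariski_near S -> zariski_near T -> zariski_near (fun z => S z /\ T z).
Proof.
case=> D D0 DS [D' D0' DT]; exists (D * D').
  by rewrite /eval_coord mevalM mulf_neq0.
move=> z zc; rewrite /eval_coord mevalM mulf_eq0 negb_or => /andP[Dz Dz'].
by split; [apply: DS|apply: DT].
Qed.

Lemma zariski_near_forall (I : finType) (S : I -> space R n m -> Prop) :
  (forall i, zariski_near (S i)) -> zariski_near (fun z => forall i, S i z).
Proof.
move=> HS; have : zariski_near (fun z => forall i, i \in enum I -> S i z).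
  elim: (enum I) => [|i s IHs]; first exact: zariski_near_true.
  apply: zariski_near_imp (zariski_near_and (HS i) IHs) _ => z _ [Si Ss] j.
  by rewrite inE => /predU1P[->//|]; apply: Ss.
by move/zariski_near_imp; apply => z _ Hz i; apply: Hz; rewrite mem_enum.
Qed.

Lemma zariski_near_generically (S : space R n m -> Prop) :
  zariski_near S -> generically S.
Proof.
by case=> D D0 DS; exists D => //; apply: contra_neq D0 => ->; rewrite /eval_coord meval0.
Qed.

(** Near [z0] the function agrees with an element of the local ring of [z0].
    This accommodates [invmx], which is rational only near invertible
    matrices. *)
Definition regular (f : space R n m -> R) : Prop :=
  exists P Q, eval_coord Q z0 != 0 /\ zariski_near (fun z =>
    eval_coord Q z != 0 /\ f z = eval_coord P z / eval_coord Q z).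

Lemma regular_near (f h : space R n m -> R) :
  regular f -> zariski_near (fun z => h z = f z) -> regular h.
Proof.
move=> [P [Q [Q0 QP]]] hf; exists P, Q; split=> //.
by apply: zariski_near_imp (zariski_near_and QP hf) _ => z _ [[? fz] ->].
Qed.

Lemma regular_eval P : regular (eval_coord P).
Proof.
exists P, 1; split; first by rewrite /eval_coord meval1 oner_neq0.
by apply: zariski_near_true => z _; rewrite /eval_coord meval1 oner_neq0 divr1.
Qed.

Lemma regular_cst (a : R) : regular (fun=> a).
Proof.
apply: regular_near (regular_eval (mpolyC _ a)) _.
by apply: zariski_near_true => z _; rewrite /eval_coord mevalC.
Qed.

Lemma regular_coord k : regular (fun z => coord z k).
Proof.
apply: regular_near (regular_eval (mpolyX R (mnm1 (enum_rank k)))) _.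
by apply: zariski_near_true => z _; rewrite /eval_coord mevalXU enum_rankK.
Qed.

Lemma regularD f h : regular f -> regular h -> regular (fun z => f z + h z).
Proof.
move=> [P [Q [Q0 QP]]] [P' [Q' [Q0' QP']]].
exists (P * Q' + P' * Q), (Q * Q'); split; first by rewrite /eval_coord mevalM mulf_neq0.
apply: zariski_near_imp (zariski_near_and QP QP') _ => z _ [[Qz ->] [Qz' ->]].
by rewrite /eval_coord mevalD !mevalM mulf_neq0 // addf_div.
Qed.

Lemma regularM f h : regular f -> regular h -> regular (fun z => f z * h z).
Proof.
move=> [P [Q [Q0 QP]]] [P' [Q' [Q0' QP']]].
exists (P * P'), (Q * Q'); split; first by rewrite /eval_coord mevalM mulf_neq0.
apply: zariski_near_imp (zariski_near_and QP QP') _ => z _ [[Qz ->] [Qz' ->]].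
by rewrite /eval_coord !mevalM mulf_neq0 // mulf_div.
Qed.

Lemma regularN f : regular f -> regular (fun z => - f z).
Proof.
move=> rf; apply: regular_near (regularM (regular_cst (-1)) rf) _.
by apply: zariski_near_true => z _; rewrite mulN1r.
Qed.

Lemma regular_sum (I : Type) (s : seq I) (f : I -> space R n m -> R) :
  (forall i, regular (f i)) -> regular (fun z => \sum_(i <- s) f i z).
Proof.
move=> rf; elim: s => [|i s IHs].
  by apply: regular_near (regular_cst 0) _; apply: zariski_near_true => z _; rewrite big_nil.
apply: regular_near (regularD (rf i) IHs) _.
by apply: zariski_near_true => z _; rewrite big_cons.
Qed.

Lemma regular_prod (I : Type) (s : seq I) (f : I -> space R n m -> R) :
  (forall i, regular (f i)) -> regular (fun z => \prod_(i <- s) f i z).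
Proof.
move=> rf; elim: s => [|i s IHs].
  by apply: regular_near (regular_cst 1) _; apply: zariski_near_true => z _; rewrite big_nil.
apply: regular_near (regularM (rf i) IHs) _.
by apply: zariski_near_true => z _; rewrite big_cons.
Qed.

Lemma regularX f k : regular f -> regular (fun z => f z ^+ k).
Proof.
move=> rf; apply: regular_near (regular_prod (index_enum (ordinal k)) (fun=> rf)) _.
by apply: zariski_near_true => z _; rewrite prodr_const card_ord.
Qed.

Lemma regular_meval N (p : mpoly N R) (f : 'I_N -> space R n m -> R) :
  (forall i, regular (f i)) -> regular (fun z => meval (f^~ z) p).
Proof.
move=> rf; apply: (@regular_near (fun z => \sum_(k <- msupp p) mcoeff k p * \prod_i f i z ^+ k i)).
  apply: regular_sum => k; apply: regularM (regular_cst _) _.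
  by apply: regular_prod => i; exact: regularX.
by apply: zariski_near_true => z _; rewrite mevalE.
Qed.

Hypothesis z0c : in_chart z0.

Lemma zariski_near_self S : zariski_near S -> S z0.
Proof. by case=> D D0; apply. Qed.

(** The germs that do not vanish at [z0] are the units of the local ring. *)
Lemma regular_neq0 f : regular f -> f z0 != 0 ->
  exists P Q, [/\ eval_coord P z0 != 0, eval_coord Q z0 != 0 &
    zariski_near (fun z => [/\ eval_coord P z != 0, eval_coord Q z != 0
                             & f z = eval_coord P z / eval_coord Q z])].
Proof.
move=> [P [Q [Q0 QP]]] f0; have [_ fz0] := zariski_near_self QP.
have P0 : eval_coord P z0 != 0.
  by apply: contra_neq f0 => P0; rewrite fz0 P0 mul0r.
exists P, Q; split=> //; have Pnear : zariski_near (fun z => eval_coord P z != 0).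
  by exists P.
by apply: zariski_near_imp (zariski_near_and Pnear QP) _ => z _ [? []].
Qed.

Lemma zariski_near_neq0 f : regular f -> f z0 != 0 -> zariski_near (fun z => f z != 0).
Proof.
move=> rf /(regular_neq0 rf)[P [Q [_ _ /zariski_near_imp]]]; apply => z _ [P0 Q0 ->].
by rewrite mulf_neq0 ?invr_eq0.
Qed.

Lemma regularV f : regular f -> f z0 != 0 -> regular (fun z => (f z)^-1).
Proof.
move=> rf /(regular_neq0 rf)[P [Q [P0 Q0 PQ]]]; exists Q, P; split=> //.
by apply: zariski_near_imp PQ _ => z _ [? ? ->]; rewrite invf_div.
Qed.

Definition mx_regular p q (M : space R n m -> 'M[R]_(p, q)) : Prop :=
  forall i j, regular (fun z => M z i j).

Lemma mx_regularM p q r (M : space R n m -> 'M[R]_(p, q)) (M' : space R n m -> 'M[R]_(q, r)) :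
  mx_regular M -> mx_regular M' -> mx_regular (fun z => M z *m M' z).
Proof.
move=> rM rM' i j; apply: (@regular_near (fun z => \sum_k M z i k * M' z k j)).
  by apply: regular_sum => k; exact: regularM.
by apply: zariski_near_true => z _; rewrite mxE.
Qed.

Lemma regular_det p (M : space R n m -> 'M[R]_p) :
  mx_regular M -> regular (fun z => \det (M z)).
Proof.
move=> rM; apply: regular_sum => s; apply: regularM (regular_cst _) _.
by apply: regular_prod => i; exact: rM.
Qed.

(** Cramer's rule. *)
Lemma mx_regularV p (M : space R n m -> 'M[R]_p) :
  mx_regular M -> M z0 \in unitmx -> mx_regular (fun z => invmx (M z)).
Proof.
move=> rM; rewrite unitmxE unitfE => M0 i j.
have rdet := regular_det rM.
have radj : regular (fun z => (\adj (M z)) i j).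
  apply: (@regular_near (fun z => (-1) ^+ (j + i) * \det (row' j (col' i (M z))))).
    apply: regularM (regular_cst _) (regular_det _) => k l.
    by apply: regular_near (rM (lift j k) (lift i l)) _; apply: zariski_near_true => z _; rewrite !mxE.
  by apply: zariski_near_true => z _; rewrite !mxE.
apply: regular_near (regularM (regularV rdet M0) radj) _.
apply: zariski_near_imp (zariski_near_neq0 rdet M0) _ => z _ Mz.
by rewrite /invmx unitmxE unitfE Mz !mxE.
Qed.

Lemma mx_near_unit p (M : space R n m -> 'M[R]_p) :
  mx_regular M -> M z0 \in unitmx -> zariski_near (fun z => M z \in unitmx).
Proof.
move=> rM; rewrite unitmxE unitfE => M0.
apply: zariski_near_imp (zariski_near_neq0 (regular_det rM) M0) _ => z _.
by rewrite unitmxE unitfE.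
Qed.

End LocalRational.

Section Pullback.
Variables (R : realType) (n m m' : nat).
Variables (phi : space R n m -> space R n m') (z0 : space R n m).
Hypothesis z0c : in_chart z0.
Hypothesis phi_chart : zariski_near z0 (fun z => in_chart (phi z)).
Hypothesis phi_regular : forall k, regular z0 (fun z => coord (phi z) k).

Lemma regular_eval_pullback (P : coord_poly R n m') :
  regular z0 (fun z => eval_coord P (phi z)).
Proof. exact: (@regular_meval _ _ _ _ _ _ (fun i z => coord (phi z) (enum_val i))). Qed.

(** Continuity at [z0] for the Zariski topology.  Only the image of a single point
    enters, so the statement serves for maps that are not dominant, such as the
    slice map below. *)
Lemma zariski_near_pullback S :
  zariski_near (phi z0) S -> zariski_near z0 (fun z => S (phi z)).
Proof.
case=> D D0 DS; have := zariski_near_neq0 z0c (regular_eval_pullback D) D0.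
by move/(zariski_near_and phi_chart)/zariski_near_imp; apply => z _ [? ?]; exact: DS.
Qed.

End Pullback.

(** * The prolonged projective action in homogeneous coordinates *)

Section Projectivities.
Variable R : realType.
Implicit Types (M N : 'M[R]_3) (g h : pgl3 R) (k : R).

(** A singular [M] is sent to the identity. *)
Definition projectivity M : pgl3 R := \pi_(pgl3 R)%qT (insubd (gl3_one R) M).

Lemma projectivity_repr M : M \in unitmx ->
  exists2 k, k != 0 & val (repr (projectivity M)) = k *: M.
Proof.
by move=> Mu; have [k k0 ->] := repr_proportional (insubd (gl3_one R) M);
  exists k; rewrite // insubdK.
Qed.

Lemma projectivityK g : projectivity (val (repr g)) = g.
Proof. by rewrite /projectivity valKd reprK. Qed.

Lemma eq_projectivity M N k : M \in unitmx -> k != 0 -> N = k *: M ->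
  projectivity N = projectivity M.
Proof.
move=> Mu k0 NM; have Nu : N \in unitmx by rewrite NM unitmxZ // unitfE.
by apply/pi_proportional; exists k; rewrite ?insubdK.
Qed.

Lemma projectivityM M N : M \in unitmx -> N \in unitmx ->
  projectivity (M *m N) = (projectivity M * projectivity N)%g.
Proof.
move=> Mu Nu; rewrite [RHS]pgl3_mulE; congr (\pi_(pgl3 R)%qT _).
by apply: val_inj; rewrite /= !insubdK // unitmx_mul Mu.
Qed.

Lemma projectivity1 : projectivity 1%:M = 1%g.
Proof. by congr (\pi_(pgl3 R)%qT _); apply: val_inj; rewrite insubdK ?unitmx1. Qed.

Lemma projectivityV M : M \in unitmx -> projectivity (invmx M) = (projectivity M)^-1%g.
Proof.
move=> Mu; apply/esym/mulg1_eq.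
by rewrite -projectivityM ?unitmx_inv // mulmxV // projectivity1.
Qed.

Lemma entry_projectivity M i j : M \in unitmx ->
  entry (projectivity M) i j / entry (projectivity M) 2 2 = M i j / M 2 2.
Proof.
move=> Mu; rewrite /entry; have [k k0 ->] := projectivity_repr Mu.
by rewrite !mxE -mulf_div mulfV // mul1r.
Qed.

Lemma entry_projectivity_neq0 M i j : M \in unitmx ->
  (entry (projectivity M) i j != 0) = (M i j != 0).
Proof.
move=> Mu; rewrite /entry; have [k k0 ->] := projectivity_repr Mu.
by rewrite mxE mulf_eq0 (negbTE k0).
Qed.

End Projectivities.

Section Prolongation.
Variable R : realType.
Implicit Types (M N : 'M[R]_3) (g h : pgl3 R) (z : jet R) (k : R).

Definition jet_point z : 'cV[R]_3 := \col_i nth 0 [:: jx z; jy z; 1] i.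

(** The linear form on homogeneous coordinates that restricts to the covector
    [(p, q)] on directions and vanishes at the point of the jet. *)
Definition jet_form z : 'rV[R]_3 :=
  \row_i nth 0 [:: jp z; jq z; - (jp z * jx z + jq z * jy z)] i.

Definition mx_den M z : R := (M *m jet_point z) 2 0.

(** In homogeneous coordinates the first prolongation is linear: points are
    multiplied by [M] and forms by [invmx M], and the denominator restores the
    normalizations of both.  [act1E] identifies this with the prolongation given
    by the Jacobian matrix. *)
Definition mx_act M z : jet R :=
  let v := M *m jet_point z in let l := mx_den M z *: (jet_form z *m invmx M) in
  Jet (v 0 0 / mx_den M z) (v 1 0 / mx_den M z) (l 0 0) (l 0 1).

Lemma scalemxE p q k (A : 'M[R]_(p, q)) i j : (k *: A) i j = k * A i j.
Proof. exact: mxE. Qed.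

Lemma sum3 (f : 'I_3 -> R) : \sum_i f i = f 0 + f 1 + f 2.
Proof.
rewrite !big_ord_recl big_ord0 addr0 addrA.
by congr (f _ + f _ + f _); apply/val_inj.
Qed.

Lemma ord3P (P : 'I_3 -> Prop) : P 0 -> P 1 -> P 2 -> forall i, P i.
Proof.
move=> P0 P1 P2 [[|[|[|i]]]] // Hi.
- by rewrite (_ : Ordinal Hi = 0) //; apply/val_inj.
- by rewrite (_ : Ordinal Hi = 1) //; apply/val_inj.
- by rewrite (_ : Ordinal Hi = 2) //; apply/val_inj.
Qed.

Lemma jet_form_point z : jet_form z *m jet_point z = 0.
Proof.
apply/matrixP => i j; rewrite !mxE sum3 !mxE /=; ring.
Qed.

Lemma proj_denE g z : proj_den g (jx z) (jy z) = mx_den (val (repr g)) z.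
Proof. by rewrite /mx_den mxE sum3 !mxE /= mulr1. Qed.

Lemma mx_denZ k M z : mx_den (k *: M) z = k * mx_den M z.
Proof. by rewrite /mx_den -scalemxAl mxE. Qed.

Lemma mx_actZ k M z : M \in unitmx -> k != 0 -> mx_act (k *: M) z = mx_act M z.
Proof.
move=> Mu k0; rewrite /mx_act mx_denZ -scalemxAl.
have -> : invmx (k *: M) = k^-1 *: invmx M by rewrite invmxZ // unitmxZ // unitfE.
rewrite -scalemxAr scalerA mulrAC mulfV // mul1r !scalemxE.
by congr Jet; rewrite // -mulf_div mulfV // mul1r.
Qed.

Lemma jet_point_act M z : mx_den M z != 0 ->
  jet_point (mx_act M z) = (mx_den M z)^-1 *: (M *m jet_point z).
Proof.
move=> d0; apply/matrixP => i j; rewrite (ord1 j) [LHS]mxE [RHS]mxE.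
elim/ord3P: i => /=; rewrite 1?mulrC //.
by rewrite -/(mx_den M z) mulfV.
Qed.

(** The first two coordinates agree by definition of [mx_act]; the third one is
    forced, because both sides vanish at the transformed point, whose last
    coordinate is 1. *)
Lemma jet_form_act M z : M \in unitmx -> mx_den M z != 0 ->
  jet_form (mx_act M z) = mx_den M z *: (jet_form z *m invmx M).
Proof.
move=> Mu d0; apply/matrixP => i j; rewrite (ord1 i).
set l := _ *: _; have lv : l *m jet_point (mx_act M z) = 0.
  rewrite jet_point_act // /l -scalemxAl -scalemxAr mulmxA mulmxKV //.
  by rewrite jet_form_point !scaler0.
have := congr1 (fun A : 'M_1 => A 0 0) lv; rewrite [LHS]mxE [RHS]mxE sum3.
have jp0 : jet_point (mx_act M z) 0 0 = jx (mx_act M z) by rewrite mxE.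
have jp1 : jet_point (mx_act M z) 1 0 = jy (mx_act M z) by rewrite mxE.
have jp2 : jet_point (mx_act M z) 2 0 = 1 by rewrite mxE.
have jpE : jp (mx_act M z) = l 0 0 by [].
have jqE : jq (mx_act M z) = l 0 1 by [].
rewrite jp0 jp1 jp2 mulr1 => E; rewrite mxE jpE jqE.
elim/ord3P: j => //=.
by apply/eqP; rewrite eq_sym -addr_eq0 addrC E.
Qed.

Lemma mx_act_id z : mx_act 1%:M z = z.
Proof.
rewrite /mx_act /mx_den mul1mx invmx1 mulmx1 !mxE /=.
by rewrite !divr1 !mul1r; case: z.
Qed.

Lemma mx_denM M N z : mx_den N z != 0 ->
  mx_den (M *m N) z = mx_den M (mx_act N z) * mx_den N z.
Proof.
move=> N0; rewrite {2}/mx_den jet_point_act // -scalemxAr mxE mulmxA.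
by rewrite mulrAC mulVf // mul1r.
Qed.

Lemma invmx_mul M N : M \in unitmx -> N \in unitmx ->
  invmx (M *m N) = invmx N *m invmx M.
Proof.
move=> Mu Nu; have MNu : M *m N \in unitmx by rewrite unitmx_mul Mu.
have E : M *m N *m (invmx N *m invmx M) = 1%:M by rewrite mulmxA mulmxK // mulmxV.
by rewrite -[RHS](mulKmx MNu) E mulmx1.
Qed.

Lemma mx_actM M N z : M \in unitmx -> N \in unitmx ->
  mx_den N z != 0 -> mx_act M (mx_act N z) = mx_act (M *m N) z.
Proof.
move=> Mu Nu N0; rewrite {1}/mx_act jet_form_act // jet_point_act //.
rewrite [RHS]/mx_act mx_denM // -!scalemxAr -!scalemxAl invmx_mul // !mulmxA.
rewrite scalerA !scalemxE.
by congr Jet; rewrite // -mulrA mulrC invfM !mulrA.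
Qed.

Lemma is_derive_affine (u0 u1 t : R) : is_derive t 1 (fun s : R => u0 * s + u1) u0.
Proof.
rewrite (_ : (fun s : R => _) = (u0 \*: id + cst u1)); last by apply/funext.
by apply: is_derive_eq; rewrite addr0 [LHS]mulr1.
Qed.

Lemma derive1_homographic (u0 u1 w0 w1 t : R) : w0 * t + w1 != 0 ->
  derive1 (fun s => (u0 * s + u1) / (w0 * s + w1)) t =
  (u0 - (u0 * t + u1) / (w0 * t + w1) * w0) / (w0 * t + w1).
Proof.
move=> d0; rewrite derive1E.
pose f (s : R) := u0 * s + u1; pose h (s : R) := w0 * s + w1.
have [f1 fE] : is_derive t 1 f u0 := is_derive_affine u0 u1 t.
have [h1 hE] : is_derive t 1 h w0 := is_derive_affine w0 w1 t.
have ht : h t != 0 by [].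
transitivity ('D_1 (f * (fun s => (h s)^-1)) t); first by [].
rewrite (deriveM f1 (derivableV ht h1)) (deriveV ht h1) fE hE /GRing.scale /=.
by rewrite /f /h; field.
Qed.

Definition jet_covector z : 'rV[R]_2 := \row_j (if j == 0 then jp z else jq z).

Lemma ord2P (P : 'I_2 -> Prop) : P 0 -> P 1 -> forall i, P i.
Proof.
move=> P0 P1 [[|[|i]]] // Hi.
- by rewrite (_ : Ordinal Hi = 0) //; apply/val_inj.
- by rewrite (_ : Ordinal Hi = 1) //; apply/val_inj.
Qed.

(** The quotient rule applied to the two components of the projective map. *)
Lemma proj_jacobianE g z (i j : 'I_2) (A := val (repr g)) (w := widen_ord (leqnSn 2)) :
  mx_den A z != 0 -> proj_jacobian g (jx z) (jy z) i j =
  (A (w i) (w j) - (A *m jet_point z) (w i) 0 / mx_den A z * A 2 (w j)) / mx_den A z.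
Proof.
move=> d0; have w0 : w 0 = 0 by apply/val_inj.
have w1 : w 1 = 1 by apply/val_inj.
have dE : mx_den A z = entry g 2 0 * jx z + entry g 2 1 * jy z + entry g 2 2.
  by rewrite -proj_denE.
have vE (k : 'I_3) : (A *m jet_point z) k 0 = entry g k 0 * jx z + entry g k 1 * jy z + entry g k 2.
  by rewrite mxE sum3 !mxE /= mulr1.
have Hx (k : 'I_3) : derive1 (fun s => (entry g k 0 * s + entry g k 1 * jy z + entry g k 2) /
    (entry g 2 0 * s + entry g 2 1 * jy z + entry g 2 2)) (jx z) =
  (A k 0 - (A *m jet_point z) k 0 / mx_den A z * A 2 0) / mx_den A z.
  rewrite vE dE; under eq_fun => s do rewrite -!addrA.
  by rewrite derive1_homographic !addrA // -dE.
have Hy (k : 'I_3) : derive1 (fun s => (entry g k 0 * jx z + entry g k 1 * s + entry g k 2) /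
    (entry g 2 0 * jx z + entry g 2 1 * s + entry g 2 2)) (jy z) =
  (A k 1 - (A *m jet_point z) k 0 / mx_den A z * A 2 1) / mx_den A z.
  have sw (k' : 'I_3) (s : R) : entry g k' 0 * jx z + entry g k' 1 * s + entry g k' 2 =
      entry g k' 1 * s + (entry g k' 0 * jx z + entry g k' 2).
    by rewrite addrAC addrC.
  rewrite vE dE !sw; under eq_fun => s do rewrite !sw.
  by rewrite derive1_homographic // -sw -dE.
rewrite mxE; elim/ord2P: i; elim/ord2P: j => /=; rewrite ?w0 ?w1.
- exact: Hx.
- exact: Hy.
- exact: Hx.
- exact: Hy.
Qed.

(** Contract the Jacobian with the transformed form [l].  The second term of the
    quotient rule is proportional to the value of [l] at the transformed point
    minus its last coordinate, so it supplies exactly the missing third summand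
    of [l *m A]. *)
Lemma jacobian_covector g z (A := val (repr g)) : mx_den A z != 0 ->
  jet_covector (mx_act A z) *m proj_jacobian g (jx z) (jy z) = jet_covector z.
Proof.
move=> d0; have Au : A \in unitmx := valP (repr g).
pose d := mx_den A z; pose l := jet_form (mx_act A z); pose v := A *m jet_point z.
have lE : l = d *: (jet_form z *m invmx A) by exact: jet_form_act.
have lv : l 0 0 * v 0 0 + l 0 1 * v 1 0 + l 0 2 * d = 0.
  have : l *m v = 0.
    by rewrite lE /v -scalemxAl mulmxA mulmxKV // jet_form_point scaler0.
  by move/(congr1 (fun B : 'M_1 => B 0 0)); rewrite [LHS]mxE sum3 [RHS]mxE.
have lA (k : 'I_3) : l 0 0 * A 0 k + l 0 1 * A 1 k + l 0 2 * A 2 k = d * jet_form z 0 k.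
  transitivity ((l *m A) 0 k); first by rewrite [RHS]mxE sum3.
  by rewrite lE -scalemxAl mulmxKV // scalemxE.
apply/matrixP => i j; rewrite (ord1 i) mxE big_ord_recl big_ord1 !proj_jacobianE //.
rewrite -/d -/v.
have -> : widen_ord (leqnSn 2) ord0 = 0 by exact/val_inj.
have -> : widen_ord (leqnSn 2) (lift ord0 ord0) = 1 by exact/val_inj.
have -> : jet_covector (mx_act A z) 0 ord0 = l 0 0 by rewrite !mxE.
have -> : jet_covector (mx_act A z) 0 (lift ord0 ord0) = l 0 1 by rewrite !mxE.
have -> : jet_covector z 0 j = jet_form z 0 (widen_ord (leqnSn 2) j).
  by elim/ord2P: j; rewrite !mxE.
set k := widen_ord _ j.
apply: (mulfI d0); rewrite -/d -lA.
have l2 : l 0 2 = - (l 0 0 * v 0 0 + l 0 1 * v 1 0) / d.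
  by apply: (mulIf d0); rewrite mulfVK //; apply/eqP; rewrite -subr_eq0 opprK addrC -[X in _ == X]lv.
by rewrite l2; field.
Qed.

(** The Jacobian is invertible because, by [jacobian_covector], both basis
    covectors are in its image. *)
Lemma act1E g z : mx_den (val (repr g)) z != 0 -> act1 g z = mx_act (val (repr g)) z.
Proof.
move=> d0; have Ju : proj_jacobian g (jx z) (jy z) \in unitmx.
  pose z1 := Jet (jx z) (jy z) 1 0; pose z2 := Jet (jx z) (jy z) 0 1.
  pose L := col_mx (jet_covector (mx_act (val (repr g)) z1))
                   (jet_covector (mx_act (val (repr g)) z2)) : 'M_(1 + 1).
  suff /mulmx1_unit[] : L *m proj_jacobian g (jx z) (jy z) = 1%:M by [].
  rewrite mul_col_mx (@jacobian_covector g z1) // (@jacobian_covector g z2) //.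
  apply/matrixP => i j; rewrite mxE.
  case: splitP => k; rewrite (ord1 k) => ik; rewrite !mxE.
    have -> : i = 0 by exact/val_inj.
    by elim/ord2P: j.
  have -> : i = 1 by exact/val_inj.
  by elim/ord2P: j.
rewrite /act1 -/(jet_covector z) -(jacobian_covector d0) mulmxK //.
rewrite /proj_x /proj_y proj_denE !mxE /mx_act.
congr Jet.
- by rewrite mxE sum3 !mxE /= mulr1.
- by rewrite mxE sum3 !mxE /= mulr1.
Qed.

Lemma act1_projectivity M z : M \in unitmx -> mx_den M z != 0 ->
  act1 (projectivity M) z = mx_act M z.
Proof.
move=> Mu d0; have [k k0 kM] := projectivity_repr Mu.
by rewrite act1E kM ?mx_actZ // mx_denZ mulf_neq0.
Qed.

(** Finiteness of the image: the action law holds along such points. *)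
Definition projectable g z := proj_den g (jx z) (jy z) != 0.

Lemma projectableE M z : M \in unitmx -> projectable (projectivity M) z = (mx_den M z != 0).
Proof.
move=> Mu; rewrite /projectable proj_denE; have [k k0 ->] := projectivity_repr Mu.
by rewrite mx_denZ mulf_eq0 (negbTE k0).
Qed.

Lemma projectable1 z : projectable 1%g z.
Proof.
by rewrite -projectivity1 projectableE ?unitmx1 // /mx_den mul1mx mxE /= oner_neq0.
Qed.

Lemma act1_1 z : act1 1%g z = z.
Proof.
by rewrite -projectivity1 act1_projectivity ?unitmx1 ?mx_act_id //
  -projectableE ?unitmx1 // projectivity1 projectable1.
Qed.

Lemma projectableM g h z : projectable h z ->
  projectable (g * h)%g z = projectable g (act1 h z).
Proof.
rewrite -(projectivityK g) -(projectivityK h).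
have gu : val (repr g) \in unitmx := valP (repr g).
have hu : val (repr h) \in unitmx := valP (repr h).
move: (val (repr g)) (val (repr h)) gu hu => M N Mu Nu; rewrite (projectableE _ Nu) => N0.
rewrite (act1_projectivity Nu N0) -(projectivityM Mu Nu).
rewrite (projectableE _ Mu) projectableE ?unitmx_mul ?Mu //.
by rewrite (mx_denM M N0) mulf_eq0 (negbTE N0) orbF.
Qed.

Lemma act1M g h z : projectable h z -> projectable (g * h)%g z ->
  act1 (g * h)%g z = act1 g (act1 h z).
Proof.
move=> hz; rewrite (projectableM g hz); move: hz.
rewrite -(projectivityK g) -(projectivityK h).
have gu : val (repr g) \in unitmx := valP (repr g).
have hu : val (repr h) \in unitmx := valP (repr h).
move: (val (repr g)) (val (repr h)) gu hu => M N Mu Nu; rewrite (projectableE _ Nu) => N0.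
rewrite (act1_projectivity Nu N0) (projectableE _ Mu) => M0.
rewrite -(projectivityM Mu Nu) (act1_projectivity Mu M0) (mx_actM Mu Nu N0).
apply: act1_projectivity; first by rewrite unitmx_mul Mu.
by rewrite (mx_denM M N0) mulf_neq0.
Qed.

End Prolongation.

(** * Points in general position *)

Section GenericPoints.
Variables (R : realType) (n : nat).
Implicit Types m : nat.

Lemma generically_and m (S T : space R n m -> Prop) :
  generically S -> generically T -> generically (fun z => S z /\ T z).
Proof.
move=> [D D0 DS] [D' D0' DT]; exists (D * D'); first exact: mulf_neq0.
move=> z zc; rewrite /eval_coord mevalM mulf_eq0 negb_or => /andP[Dz Dz'].
by split; [apply: DS|apply: DT].
Qed.

Lemma generically_imp m (S T : space R n m -> Prop) :
  generically S -> (forall z, in_chart z -> S z -> T z) -> generically T.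
Proof.
by case=> D D0 DS ST; exists D => // z zc Dz; apply: ST => //; apply: DS.
Qed.

(** A nonempty Zariski open set is a neighbourhood of each of its points. *)
Lemma generically_near m (S : space R n m -> Prop) :
  generically S -> generically (fun z => zariski_near z S).
Proof. by case=> D D0 DS; exists D => // z zc Dz; exists D. Qed.

(** The matrix with normalized last entry 1 and other entries prescribed by the
    affine coordinates [w]; [T] is either the field of scalars or the ring of
    coordinate polynomials. *)
Definition normal_mx (T : nzRingType) m (w : coord_index n m -> T) (i : 'I_m) : 'M[T]_3 :=
  \matrix_(a, b) if insub (a, b) is Some k then w (inl (i, k)) else 1.

(** A vector of coordinates comes from a point as soon as the normalized
    matrices it prescribes are invertible.  So the nonroot is taken of [D] times
    the determinants of these matrices, a product that is nonzero because
    the identity matrices are among the possible values. *)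
Lemma generically_point m (S : space R n m -> Prop) :
  generically S -> exists2 z, in_chart z & S z.
Proof.
case=> D D0 DS.
pose X (k : coord_index n m) : coord_poly R n m := mpolyX R (mnm1 (enum_rank k)).
pose d := \prod_i \det (normal_mx X i).
have dE v : meval v d = \prod_i \det (normal_mx (v \o enum_rank) i).
  rewrite rmorph_prod; apply: eq_bigr => i _; rewrite -det_map_mx.
  congr (\det _); apply/matrixP => a b; rewrite !mxE.
  by case: insubP => [k _ _|_]; [exact: mevalXU|exact: meval1].
have d0 : d != 0.
  (* The coordinates of the identity matrices. *)
  pose v0 (k : coord_index n m) : R := if k is inl (_, k) then ((val k).1 == (val k).2)%:R else 0.
  apply/eqP => /(congr1 (meval (v0 \o enum_val)))/eqP.
  rewrite dE meval0 prodf_seq_eq0 => /hasP[i _].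
  rewrite (_ : normal_mx _ i = 1%:M) ?det1 ?oner_eq0 //.
  apply/matrixP => a b; rewrite !mxE; case: insubP => [k _ /= kE|].
    by rewrite enum_rankK /= kE.
  by rewrite negbK => /eqP[-> ->]; rewrite eqxx.
have [v] := mpoly_nonroot (mulf_neq0 D0 d0).
rewrite mevalM mulf_eq0 negb_or => /andP[Dv]; rewrite dE => /prodf_neq0 du.
pose w := v \o enum_rank; pose M i := normal_mx w i.
have Mu i : M i \in unitmx by rewrite unitmxE unitfE du.
have M22 i : M i 2 2 = 1 by rewrite mxE insubN // negbK.
pose z : space R n m := (fun i => projectivity (M i), fun i =>
  Jet (w (inr (i, 0))) (w (inr (i, 1))) (w (inr (i, 2))) (w (inr (i, 3)))).
have zc : in_chart z by move=> i; rewrite entry_projectivity_neq0 // M22 oner_neq0.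
exists z => //; apply: DS => //; rewrite /eval_coord.
have zE k : coord z (enum_val k) = v k.
  rewrite -[in RHS](enum_valK k) -[v (enum_rank _)]/(w (enum_val k)).
  case: (enum_val k) => -[i j].
    rewrite /coord /= entry_projectivity // M22 divr1 mxE -surjective_pairing.
    by rewrite valK.
  rewrite /coord /=; case: j => [[|[|[|[|j]]]]] //= Hj; congr (w (inr (_, _))); exact/val_inj.
by rewrite (meval_eq _ zE).
Qed.

End GenericPoints.

Section TupleSurgery.
Variable T : Type.

Definition snoc m (g : 'I_m -> T) (h : T) : 'I_m.+1 -> T :=
  fun j => if unlift ord_max j is Some k then g k else h.

Lemma snoc_widen m (g : 'I_m -> T) h j : snoc g h (widen_ord (leqnSn m) j) = g j.
Proof.
have -> : widen_ord (leqnSn m) j = lift ord_max j by exact/val_inj/esym/lift_max.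
by rewrite /snoc liftK.
Qed.

Lemma snoc_max m (g : 'I_m -> T) h : snoc g h ord_max = h.
Proof. by rewrite /snoc unlift_none. Qed.

Lemma eq_snoc m (f : 'I_m.+1 -> T) (g : 'I_m -> T) h :
  (forall j, f (widen_ord (leqnSn m) j) = g j) -> f ord_max = h -> f = snoc g h.
Proof.
move=> fg fh; apply/funext => j; case: (unliftP ord_max j) => [k|] ->; last first.
  by rewrite snoc_max.
have -> : lift ord_max k = widen_ord (leqnSn m) k by exact/val_inj/lift_max.
by rewrite snoc_widen.
Qed.

End TupleSurgery.

(** * A rational moving frame *)

Section Frame.
Variables (R : realType) (n : nat) (i0 i1 i2 : 'I_n).
Implicit Types (x y : jets R n) (g : pgl3 R) (m : nat).

(** Under [g] this number is multiplied by the quotient of the denominators of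
    [g] at the points [i0] and [i]. *)
Definition contact x i : R := (jet_form (x i0) *m jet_point (x i)) 0 0.

Definition frame_index (b : 'I_3) : 'I_n := nth i0 [:: i0; i1; i2] b.

(** A column [jet_point (x i)] is divided by the denominator of [g] at [i] when
    [g] acts.  Up to a common factor, the weights 1, 1 / contact i1 and
    1 / contact i2 compensate for this; they are multiplied here by both
    contacts to stay polynomial. *)
Definition frame_weight x (b : 'I_3) : R :=
  nth 0 [:: contact x i1 * contact x i2; contact x i2; contact x i1] b.

Definition frame_mx x : 'M[R]_3 :=
  \matrix_(a, b) (frame_weight x b * jet_point (x (frame_index b)) a 0).

Definition frame x : pgl3 R := projectivity (frame_mx x).

(** No point of the configuration is sent to infinity by [g]. *)
Definition transversal g x := forall i, projectable g (x i).

Lemma transversal1 x : transversal 1%g x.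
Proof. by move=> i; apply: projectable1. Qed.

Lemma act_1 x : act 1%g x = x.
Proof. by apply/funext => i; exact: act1_1. Qed.

Lemma act_mul g h x : transversal h x -> transversal (g * h)%g x ->
  act (g * h)%g x = act g (act h x).
Proof. by move=> hx ghx; apply/funext => i; apply: act1M. Qed.

Lemma transversal_act g h x :
  transversal h x -> transversal (g * h)%g x -> transversal g (act h x).
Proof. by move=> hx ghx i; have := ghx i; rewrite projectableM. Qed.

Lemma frame_mx_act g x (A := val (repr g)) (d := fun i => mx_den A (x i)) :
  transversal g x ->
  frame_mx (act g x) = (d i0 / (d i1 * d i2)) *: (A *m frame_mx x).
Proof.
move=> gx; have d0 i : d i != 0 by rewrite /d -proj_denE; exact: gx.
have Au : A \in unitmx := valP (repr g).
have aE i : act g x i = mx_act A (x i) by exact/act1E/d0.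
have cE i : contact (act g x) i = d i0 / d i * contact x i.
  rewrite /contact !aE (jet_point_act (d0 i)) (jet_form_act Au (d0 i0)) -scalemxAr -scalemxAl.
  by rewrite mulmxA mulmxKV // !scalemxE mulrA [_^-1 * _]mulrC.
have AE a b : (A *m frame_mx x) a b =
    frame_weight x b * (A *m jet_point (x (frame_index b))) a 0.
  rewrite !mxE big_distrr; apply: eq_bigr => k _ /=.
  by rewrite mxE mulrCA.
apply/matrixP => a b; rewrite mxE scalemxE AE aE (jet_point_act (d0 _)) scalemxE -/(d _).
rewrite [LHS]mulrA [RHS]mulrA; congr (_ * _).
have [D0 D1 D2] := And3 (d0 i0) (d0 i1) (d0 i2).
by elim/ord3P: b; rewrite /frame_weight /frame_index /= ?cE; field; rewrite ?D0 ?D1 ?D2.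
Qed.

Lemma frame_mx_act_unit g x : transversal g x -> frame_mx x \in unitmx ->
  frame_mx (act g x) \in unitmx.
Proof.
move=> gx xu; rewrite frame_mx_act //; have Au : val (repr g) \in unitmx := valP (repr g).
have d0 i : mx_den (val (repr g)) (x i) != 0 by rewrite -proj_denE; exact: gx.
rewrite unitmxZ ?unitmx_mul ?Au // unitfE mulf_neq0 ?invr_eq0 ?mulf_neq0 //; exact: d0.
Qed.

Lemma frame_act g x : transversal g x -> frame_mx x \in unitmx ->
  frame (act g x) = (g * frame x)%g.
Proof.
move=> gx xu; have Au : val (repr g) \in unitmx := valP (repr g).
have d0 i : mx_den (val (repr g)) (x i) != 0 by rewrite -proj_denE; exact: gx.
rewrite -[g in RHS]projectivityK -projectivityM //.
apply: (eq_projectivity _ _ (frame_mx_act gx)); first by rewrite unitmx_mul Au.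
by rewrite mulf_neq0 ?invr_eq0 ?mulf_neq0 //; exact: d0.
Qed.

Section Slice.
Variable x0 : jets R n.

(** The frame normalized so that the slice passes through [x0]. *)
Definition section x : pgl3 R := (frame x * (frame x0)^-1)%g.

(** The representative of the orbit of [x] on the slice through [x0]. *)
Definition slide x : jets R n := act (section x)^-1%g x.

Definition slice m (z : space R n m) : space R n m.+1 :=
  (snoc z.1 (section z.2), slide z.2).

Lemma section_act g x : transversal g x -> frame_mx x \in unitmx ->
  section (act g x) = (g * section x)%g.
Proof. by move=> gx xu; rewrite /section frame_act // mulgA. Qed.

Lemma act_slide x : transversal (section x)^-1%g x -> act (section x) (slide x) = x.
Proof.
by move=> sx; rewrite -act_mul // mulgV ?act_1 //; exact: transversal1.
Qed.

Lemma slide_act g x : transversal g x -> frame_mx x \in unitmx ->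
  transversal (section x)^-1%g x -> slide (act g x) = slide x.
Proof.
move=> gx xu sx; rewrite /slide (section_act gx xu) invgM.
have sg : ((section x)^-1 * g^-1 * g)%g = (section x)^-1%g by rewrite mulgVK.
by rewrite -(act_mul gx) sg.
Qed.

End Slice.

End Frame.

Section FrameRegular.
Variables (R : realType) (n : nat) (i0 i1 i2 : 'I_n) (m : nat).
Implicit Types (z : space R n m).

Section Local.
Variable z0 : space R n m.
Hypothesis z0c : in_chart z0.

Lemma regular_jet_coord i k :
  regular z0 (fun z => nth 0 [:: jx (z.2 i); jy (z.2 i); jp (z.2 i); jq (z.2 i)] (k : 'I_4)).
Proof. exact: (@regular_coord _ _ _ z0 (inr (i, k))). Qed.

Lemma regular_jet_point i : mx_regular z0 (fun z => jet_point (z.2 i)).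
Proof.
move=> a b; apply: (@regular_near _ _ _ _ (fun z => nth 0 [:: jx (z.2 i); jy (z.2 i); 1] a)).
  elim/ord3P: a => /=.
  - exact: (regular_jet_coord i 0).
  - exact: (regular_jet_coord i 1).
  - exact: regular_cst.
by apply: zariski_near_true => z _; rewrite mxE.
Qed.

Lemma regular_jet_form i : mx_regular z0 (fun z => jet_form (z.2 i)).
Proof.
move=> a b; apply: (@regular_near _ _ _ _ (fun z => nth 0 [:: jp (z.2 i); jq (z.2 i);
    - (jp (z.2 i) * jx (z.2 i) + jq (z.2 i) * jy (z.2 i))] b)).
  have rx := regular_jet_coord i 0; have ry := regular_jet_coord i 1.
  have rp := regular_jet_coord i 2; have rq := regular_jet_coord i 3.
  elim/ord3P: b => //=; apply: regularN.
  by apply: regularD; apply: regularM.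
by apply: zariski_near_true => z _; rewrite mxE.
Qed.

Lemma regular_frame_mx : mx_regular z0 (fun z => frame_mx i0 i1 i2 z.2).
Proof.
move=> a b; apply: (@regular_near _ _ _ _ (fun z => frame_weight i0 i1 i2 z.2 b *
   jet_point (z.2 (frame_index i0 i1 i2 b)) a 0)).
  apply: regularM; last exact: regular_jet_point.
  have rc i : regular z0 (fun z => contact i0 z.2 i).
    by apply: mx_regularM; [exact: regular_jet_form|exact: regular_jet_point].
  by elim/ord3P: b; rewrite /frame_weight /=; try apply: regularM.
by apply: zariski_near_true => z _; rewrite mxE.
Qed.

Lemma regular_entry k a b : regular z0 (fun z => entry (z.1 k) a b / entry (z.1 k) 2 2).
Proof.
have [/eqP ab|ab] := boolP ((a, b) == (2, 2)).
  apply: regular_near (regular_cst _ 1) _; apply: zariski_near_true => z zc.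
  by case: ab => -> ->; rewrite mulfV.
exact: (@regular_coord _ _ _ z0 (inl (k, exist _ (a, b) ab))).
Qed.

Lemma regular_mx_den (M : space R n m -> 'M[R]_3) i : mx_regular z0 M ->
  regular z0 (fun z => mx_den (M z) (z.2 i)).
Proof. by move=> rM; apply: mx_regularM => //; exact: regular_jet_point. Qed.

Lemma zariski_near_transversal k : transversal (z0.1 k) z0.2 ->
  zariski_near z0 (fun z => transversal (z.1 k) z.2).
Proof.
move=> H; apply: zariski_near_forall => i.
pose M (z : space R n m) := (entry (z.1 k) 2 2)^-1 *: val (repr (z.1 k)).
have rM : mx_regular z0 M.
  move=> a b; apply: regular_near (regular_entry k a b) _.
  by apply: zariski_near_true => z _; rewrite /M scalemxE mulrC.
have ME z : in_chart z -> projectable (z.1 k) (z.2 i) = (mx_den (M z) (z.2 i) != 0).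
  by move=> zc; rewrite mx_denZ mulf_eq0 invr_eq0 (negbTE (zc k)) /projectable proj_denE.
have den0 : mx_den (M z0) (z0.2 i) != 0 by rewrite -ME.
apply: zariski_near_imp (zariski_near_neq0 z0c (regular_mx_den i rM) den0) _ => z zc.
by rewrite ME.
Qed.

Lemma zariski_near_frame : frame_mx i0 i1 i2 z0.2 \in unitmx ->
  zariski_near z0 (fun z => frame_mx i0 i1 i2 z.2 \in unitmx).
Proof. exact/mx_near_unit/regular_frame_mx. Qed.

End Local.
End FrameRegular.

Section GenericFrame.
Variables (R : realType) (n : nat) (i0 i1 i2 : 'I_n).
Hypotheses (i01 : i0 != i1) (i02 : i0 != i2) (i12 : i1 != i2).

(** A configuration at which all the polynomial conditions used below hold, which
    shows that these conditions are generic. *)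
Definition base_jets : jets R n := fun i =>
  if i == i0 then Jet 1 0 1 0 else if i == i1 then Jet 0 0 0 0 else Jet 0 1 0 0.

Lemma base_frame_unit : frame_mx i0 i1 i2 base_jets \in unitmx.
Proof.
pose B : 'M[R]_3 := \matrix_(a, b)
  nth 0 (nth [::] [:: [:: 1; 0; 0]; [:: 1; 1; -1]; [:: 0; -1; 0]] a) b.
have e0 : base_jets i0 = Jet 1 0 1 0 by rewrite /base_jets eqxx.
have e1 : base_jets i1 = Jet 0 0 0 0.
  by rewrite /base_jets eqxx eq_sym (negbTE i01).
have e2 : base_jets i2 = Jet 0 1 0 0.
  by rewrite /base_jets ![i2 == _]eq_sym (negbTE i02) (negbTE i12).
have c1 : contact i0 base_jets i1 = -1.
  by rewrite /contact e0 e1 mxE sum3 !mxE /=; ring.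
have c2 : contact i0 base_jets i2 = -1.
  by rewrite /contact e0 e2 mxE sum3 !mxE /=; ring.
(* [B] is the inverse of the frame matrix at [base_jets]. *)
suff /mulmx1_unit[] : frame_mx i0 i1 i2 base_jets *m B = 1%:M by [].
apply/matrixP => a b; rewrite mxE sum3 !mxE /frame_weight /frame_index c1 c2 /= e0 e1 e2.
by elim/ord3P: a; elim/ord3P: b => /=; ring.
Qed.

Definition base_point m : space R n m := (fun=> 1%g, base_jets).

Lemma base_point_chart m : in_chart (base_point m).
Proof.
move=> i; rewrite /= -projectivity1 entry_projectivity_neq0 ?unitmx1 //.
by rewrite mxE eqxx oner_neq0.
Qed.

Lemma generically_frame m :
  generically (fun z : space R n m => frame_mx i0 i1 i2 z.2 \in unitmx).
Proof.
apply: (@zariski_near_generically _ _ _ (base_point m)).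
by apply: zariski_near_frame; [exact: base_point_chart|exact: base_frame_unit].
Qed.

Lemma generically_transversal m (k : 'I_m) :
  generically (fun z : space R n m => transversal (z.1 k) z.2).
Proof.
apply: (@zariski_near_generically _ _ _ (base_point m)).
by apply: zariski_near_transversal; [exact: base_point_chart|exact: transversal1].
Qed.
End GenericFrame.

(** * Cochains as rational functions, and the differential *)

Section Cochains.
Variables (R : realType) (n : nat).

Definition act_last m (z : space R n m.+1) : space R n m :=
  (fun j => z.1 (widen_ord (leqnSn m) j), act (z.1 ord_max) z.2).

Definition drop_first m (z : space R n m.+1) : space R n m :=
  (fun j => z.1 (lift ord0 j), z.2).

Lemma regular_pullback m m' (phi : space R n m -> space R n m') z0 f :
  in_chart z0 -> zariski_near z0 (fun z => in_chart (phi z)) ->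
  (forall k, regular z0 (fun z => coord (phi z) k)) ->
  regular (phi z0) f -> regular z0 (f \o phi).
Proof.
move=> z0c phic rphi [P [Q [Q0 QP]]].
have rP := regular_eval_pullback rphi P; have rQ := regular_eval_pullback rphi Q.
apply: regular_near (regularM rP (regularV z0c rQ Q0)) _.
apply: zariski_near_imp (zariski_near_pullback z0c phic rphi QP) _ => z _ [_].
exact.
Qed.

(** A point where [S] holds locally is lifted by adjoining the identity in front,
    and [S] is pulled back to a neighbourhood of the lift. *)
Lemma generically_drop_first m (S : space R n m -> Prop) :
  generically S -> generically (fun z : space R n m.+1 => S (drop_first z)).
Proof.
move/generically_near/generically_point => [z zc Sz].
pose z' : space R n m.+1 :=
  (fun j => if unlift ord0 j is Some k then z.1 k else 1%g, z.2).
have rz' : drop_first z' = z.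
  by rewrite /drop_first /=; case: z {Sz zc z'} => g x /=; congr pair; apply/funext => j; rewrite liftK.
have chart1 : entry (1%g : pgl3 R) 2 2 != 0.
  by rewrite -projectivity1 entry_projectivity_neq0 ?unitmx1 // mxE eqxx oner_neq0.
have z'c : in_chart z' by move=> j /=; case: (unlift _ _).
apply: (@zariski_near_generically _ _ _ z').
apply: zariski_near_pullback => //; last by rewrite rz'.
- by apply: zariski_near_true => w wc j; exact: wc.
- case=> [[j k]|[i k]].
  + exact: (@regular_coord _ _ _ z' (inl (lift ord0 j, k))).
  + exact: (@regular_coord _ _ _ z' (inr (i, k))).
Qed.

Lemma cochain_regular m (c : map_space R n m) :
  cochains c -> generically (fun z => regular z c).
Proof.
move=> [_ [P [Q [P0 Q0 cPQ]]]].
have Qg : generically (fun z : space R n m => eval_coord Q z != 0) by exists Q.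
apply: generically_imp (generically_and Qg (generically_near (generically_and Qg cPQ))) _.
by move=> z zc [Qz near_z]; exists P, Q.
Qed.

(** A function without zeros need only be regular at one point of the chart to
    represent a nonzero rational function. *)
Lemma regular_cochain m (c : map_space R n m) z0 : in_chart z0 ->
  (forall z, c z != 0) -> regular z0 c -> cochains c.
Proof.
move=> z0c c0 /(regular_neq0 z0c)/(_ (c0 z0))[P [Q [P0 Q0 PQ]]]; split=> //.
have nz (D : coord_poly R n m) : eval_coord D z0 != 0 -> D != 0.
  by apply: contra_neq => ->; rewrite /eval_coord meval0.
exists P, Q; split; try exact: nz.
by apply: zariski_near_generically (zariski_near_imp PQ _) => z _ [].
Qed.

Lemma cochains1 m : @cochains R n m (fun=> 1).
Proof.
split=> [z|]; first exact: oner_neq0.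
exists 1, 1; split; rewrite ?oner_neq0 //; exists 1; rewrite ?oner_neq0 // => z _ _.
by rewrite /eval_coord meval1 divr1.
Qed.

Lemma cochainsM m (b c : map_space R n m) :
  cochains b -> cochains c -> cochains (fun z => b z * c z).
Proof.
move=> [b0 [P [Q [P0 Q0 PQ]]]] [c0 [P' [Q' [P0' Q0' PQ']]]].
split=> [z|]; first exact: mulf_neq0.
exists (P * P'), (Q * Q'); split; try exact: mulf_neq0.
apply: generically_imp (generically_and PQ PQ') _ => z _ [-> ->].
by rewrite /eval_coord !mevalM mulf_div.
Qed.

Lemma cochainsV m (c : map_space R n m) : cochains c -> cochains (fun z => (c z)^-1).
Proof.
move=> [c0 [P [Q [P0 Q0 PQ]]]]; split=> [z|]; first by rewrite invr_eq0.
exists Q, P; split=> //; apply: generically_imp PQ _ => z _ ->.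
by rewrite invf_div.
Qed.

(** The formula of the differentials of positive degree, in every degree.  In
    degree 0 it is the inverse of the differential. *)
Definition bar_product m (c : map_space R n m) (z : space R n m.+1) : R :=
  c (drop_first z) * (\prod_(k < m) c (merge_at z.1 k, z.2) ^ ((-1) ^+ k.+1 : int))
  * c (act_last z) ^ ((-1) ^+ m.+1 : int).

Lemma differential0 (c : map_space R n 0) z : differential c z = (bar_product c z)^-1.
Proof.
case: z => g x; rewrite /bar_product big_ord0 mulr1 expr1 invfM.
by rewrite [X in _ / X]/exprz /= invrK mulrC.
Qed.

Lemma differentialS m (c : map_space R n m.+1) z : differential c z = bar_product c z.
Proof. by case: z. Qed.

Lemma bar_productM m (b c : map_space R n m) z :
  bar_product (fun z => b z * c z) z = bar_product b z * bar_product c z.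
Proof.
rewrite /bar_product expfzMl; under eq_bigr => k _ do rewrite expfzMl.
rewrite big_split /=; ring.
Qed.

Lemma bar_productV m (c : map_space R n m) z : bar_product (fun z => (c z)^-1) z = (bar_product c z)^-1.
Proof.
rewrite /bar_product exprz_inv -invr_expz !invfM -prodfV; congr (_ * _ * _).
by apply: eq_bigr => k _; rewrite exprz_inv -invr_expz.
Qed.

Lemma differentialM m (b c : map_space R n m) z :
  differential (fun z => b z * c z) z = differential b z * differential c z.
Proof.
by case: m b c z => [|m] b c z; rewrite ?differential0 ?differentialS bar_productM // invfM.
Qed.

Lemma differentialV m (c : map_space R n m) z :
  differential (fun z => (c z)^-1) z = (differential c z)^-1.
Proof.
by case: m c z => [|m] c z; rewrite ?differential0 ?differentialS bar_productV.
Qed.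

Lemma differential1 m z : differential (fun _ : space R n m => 1) z = 1.
Proof.
have : bar_product (fun _ : space R n m => 1) z = 1.
  by rewrite /bar_product exp1rz big1 ?mulr1 // => k _; rewrite exp1rz.
by case: m z => [|m] z; rewrite ?differential0 ?differentialS => ->; rewrite ?invr1.
Qed.

(** The faces of a tuple ending in [h]: all but the last two are faces of the
    shorter tuple with [h] appended. *)
Lemma bar_product_snoc m (c : map_space R n m.+1) (z : space R n m.+1) h y :
  bar_product c (snoc z.1 h, y) =
  c (snoc (drop_first z).1 h, y)
  * (\prod_(k < m) c (snoc (merge_at z.1 k) h, y) ^ ((-1) ^+ k.+1 : int))
  * c (snoc (act_last z).1 (z.1 ord_max * h)%g, y) ^ ((-1) ^+ m.+1 : int)
  * c (z.1, act h y) ^ ((-1) ^+ m.+2 : int).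
Proof.
have barE : bar_product c (snoc z.1 h, y) = c (drop_first (snoc z.1 h, y))
  * (\prod_(k < m) c (merge_at (snoc z.1 h) (widen_ord (leqnSn m) k), y)
       ^ ((-1) ^+ k.+1 : int))
  * c (merge_at (snoc z.1 h) ord_max, y) ^ ((-1) ^+ m.+1 : int)
  * c (act_last (snoc z.1 h, y)) ^ ((-1) ^+ m.+2 : int).
  by rewrite /bar_product big_ord_recr [in LHS]mulrA.
have wl (j : 'I_m) : lift ord0 (widen_ord (leqnSn m) j) =
    widen_ord (leqnSn m.+1) (lift ord0 j) by exact/val_inj.
have lmax : lift ord0 ord_max = ord_max :> 'I_m.+2 by exact/val_inj.
have e1 : drop_first (snoc z.1 h, y) = (snoc (drop_first z).1 h, y).
  by congr pair; apply: eq_snoc => [j|] /=; rewrite ?wl ?lmax ?snoc_widen ?snoc_max.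
have e2 k : merge_at (snoc z.1 h) (widen_ord (leqnSn m) k) = snoc (merge_at z.1 k) h.
  apply: eq_snoc => [j|]; first by rewrite /merge_at /= snoc_widen wl snoc_widen.
  rewrite /merge_at /= ltnNge ltnW //= lmax snoc_max ifN //.
  by apply/eqP => /(congr1 val) /= mk; have := ltn_ord k; rewrite -mk ltnn.
have e3 : merge_at (snoc z.1 h) ord_max = snoc (act_last z).1 (z.1 ord_max * h)%g.
  apply: eq_snoc => [j|]; first by rewrite /merge_at /= ltn_ord snoc_widen.
  by rewrite /merge_at ltnn eqxx snoc_widen lmax snoc_max.
have e4 : act_last (snoc z.1 h, y) = (z.1, act h y).
  rewrite /act_last /= snoc_max; congr pair; apply/funext => j.
  by rewrite snoc_widen.
rewrite barE e1 e3 e4; under eq_bigr => k _ do rewrite e2.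
reflexivity.
Qed.

End Cochains.

(** * The contracting homotopy *)

Section SliceRegular.
Variables (R : realType) (n : nat) (i0 i1 i2 : 'I_n) (x0 : jets R n) (m : nat).
Variable z1 : space R n m.
Let frm := @frame_mx R n i0 i1 i2.
Let sec := section i0 i1 i2 x0.
Let slc := @slice R n i0 i1 i2 x0 m.
Hypotheses (x0u : frm x0 \in unitmx) (x1u : frm z1.2 \in unitmx).
Hypotheses (z1c : in_chart z1) (slc_chart : in_chart (slc z1)).
Hypothesis (trans1 : transversal (sec z1.2)^-1%g z1.2).

Let S (z : space R n m) := frm z.2 *m invmx (frm x0).

Lemma section_mx z : frm z.2 \in unitmx ->
  S z \in unitmx /\ projectivity (S z) = sec z.2.
Proof.
move=> zu; rewrite unitmx_mul zu unitmx_inv x0u; split=> //.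
by rewrite projectivityM ?unitmx_inv // projectivityV.
Qed.

Lemma regular_section_mx : mx_regular z1 S.
Proof.
apply: mx_regularM; first exact: regular_frame_mx.
by move=> a b; exact: regular_cst.
Qed.

(** The group element [section z.2] is only known up to the scalar chosen by
    [repr]; the matrices [S z] represent it near [z1] with regular entries. *)
Lemma zariski_near_section_transversal :
  zariski_near z1 (fun z => transversal (sec z.2)^-1%g z.2).
Proof.
apply: zariski_near_forall => i.
have [S1u S1E] := section_mx x1u.
have rT := mx_regularV z1c regular_section_mx S1u.
have den1 : mx_den (invmx (S z1)) (z1.2 i) != 0.
  by rewrite -projectableE ?unitmx_inv // projectivityV // S1E; exact: trans1.
have := zariski_near_and (zariski_near_frame z1c x1u)
  (zariski_near_neq0 z1c (regular_mx_den i rT) den1).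
move/zariski_near_imp; apply => z zc [zu den].
have [Su SE] := section_mx zu.
by rewrite -SE -projectivityV // projectableE // unitmx_inv.
Qed.

Lemma zariski_near_slice_chart : zariski_near z1 (fun z => in_chart (slc z)).
Proof.
have [S1u S1E] := section_mx x1u.
have S22 : S z1 2 2 != 0.
  rewrite -entry_projectivity_neq0 // S1E.
  by have := slc_chart ord_max; rewrite /= snoc_max.
have := zariski_near_and (zariski_near_frame z1c x1u)
  (zariski_near_neq0 z1c (regular_section_mx 2 2) S22).
move/zariski_near_imp; apply => z zc [zu Sz] j /=.
have [Su SE] := section_mx zu.
rewrite /snoc; case: (unlift _ _) => [k|]; first exact: zc.
by rewrite -/(sec _) -SE entry_projectivity_neq0.
Qed.

(** In the coordinates of [mx_act (invmx (S z))] everything is a quotient of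
    regular functions, with denominators that do not vanish at [z1]. *)
Lemma regular_slice k : regular z1 (fun z => coord (slc z) k).
Proof.
have [S1u S1E] := section_mx x1u.
have near_u := zariski_near_frame z1c x1u.
case: k => [[j k]|[i k]] /=.
  rewrite /snoc; case: (unlift _ _) => [l|].
    exact: (@regular_coord _ _ _ z1 (inl (l, k))).
  have S22 : S z1 2 2 != 0.
    rewrite -entry_projectivity_neq0 // S1E.
    by have := slc_chart ord_max; rewrite /= snoc_max.
  apply: regular_near (regularM (regular_section_mx (val k).1 (val k).2)
    (regularV z1c (regular_section_mx 2 2) S22)) _.
  apply: zariski_near_imp near_u _ => z _ zu; have [Su SE] := section_mx zu.
  by rewrite -/(sec _) -SE entry_projectivity.
pose T z := invmx (S z).
have rT : mx_regular z1 T := mx_regularV z1c regular_section_mx S1u.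
have rden := regular_mx_den i rT.
have den1 : mx_den (T z1) (z1.2 i) != 0.
  by rewrite -projectableE ?unitmx_inv // projectivityV // S1E; exact: trans1.
have rv : mx_regular z1 (fun z => T z *m jet_point (z.2 i)).
  by apply: mx_regularM => //; exact: regular_jet_point.
have rl : mx_regular z1 (fun z => mx_den (T z) (z.2 i) *: (jet_form (z.2 i) *m invmx (T z))).
  move=> a b; apply: (@regular_near _ _ _ _ (fun z => mx_den (T z) (z.2 i) *
    (jet_form (z.2 i) *m S z) a b)).
    apply: regularM => //; apply: mx_regularM; first exact: regular_jet_form.
    exact: regular_section_mx.
  by apply: zariski_near_true => z _; rewrite scalemxE invmxK.
have rd := regularV z1c rden den1.
apply: (@regular_near _ _ _ _ (fun z => nth 0 [:: (T z *m jet_point (z.2 i)) 0 0 / mx_den (T z) (z.2 i);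
   (T z *m jet_point (z.2 i)) 1 0 / mx_den (T z) (z.2 i);
   (mx_den (T z) (z.2 i) *: (jet_form (z.2 i) *m invmx (T z))) 0 0;
   (mx_den (T z) (z.2 i) *: (jet_form (z.2 i) *m invmx (T z))) 0 1] k)).
  case: k => [[|[|[|[|k]]]] Hk] //=.
  - exact: regularM (rv 0 0) rd.
  - exact: regularM (rv 1 0) rd.
have den_near := zariski_near_neq0 z1c rden den1.
apply: zariski_near_imp (zariski_near_and near_u den_near) _ => z _ [zu den].
have [Su SE] := section_mx zu.
suff E : slide i0 i1 i2 x0 z.2 i = mx_act (T z) (z.2 i).
  exact: (congr1 (fun w : jet R => nth 0 [:: jx w; jy w; jp w; jq w] k) E).
by rewrite /slide /act -/(sec _) -SE -projectivityV // act1_projectivity ?unitmx_inv.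
Qed.

End SliceRegular.

Section Vanishing.
Variables (R : realType) (n : nat).

(** Evaluated on the slice, the last face returns [c] itself, and by equivariance
    of the section and invariance of [slide] the other faces are those of the
    pullback of [c]. *)
Lemma bar_product_slice i0 i1 i2 (x0 : jets R n) m (c : map_space R n m.+1) (z : space R n m.+1) :
  frame_mx i0 i1 i2 z.2 \in unitmx -> transversal (z.1 ord_max) z.2 ->
  transversal (section i0 i1 i2 x0 z.2)^-1%g z.2 ->
  bar_product c (slice i0 i1 i2 x0 z) =
  bar_product (c \o @slice R n i0 i1 i2 x0 m) z * c z ^ ((-1) ^+ m.+2 : int).
Proof.
move=> zu gz sz; rewrite [LHS]bar_product_snoc act_slide // [z in c z]surjective_pairing.
case: z zu gz sz => g x /= zu gz sz.
rewrite /bar_product /= /slice /= (section_act _ gz zu) (slide_act gz zu sz).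
reflexivity.
Qed.

(** The exponent is [-1] in degree 0, where it compensates for the convention for
    the differential, and elsewhere it is realized by [b] or its inverse. *)
Lemma sign_cochain m (b : map_space R n m) : cochains b ->
  exists2 b', cochains b' & forall z, differential b' z = bar_product b z ^ ((-1) ^+ m.+1 : int).
Proof.
move=> bc; case: m b bc => [|m] b bc.
  by exists b => // z; rewrite differential0.
rewrite -signr_odd; case: (odd _); last first.
  by exists b => // z; rewrite differentialS.
exists (fun z => (b z)^-1); first exact: cochainsV.
by move=> z; rewrite differentialV differentialS.
Qed.

Lemma cocycle_coboundary (hn : (3 <= n)%N) m (c : map_space R n m.+1) :
  cocycles c -> exists2 b, cochains b & same_rational c (differential b).
Proof.
case=> cc dc; pose i0 : 'I_n := Ordinal (ltn_trans (isT : 0 < 2)%N hn).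
pose i1 : 'I_n := Ordinal (ltn_trans (isT : 1 < 2)%N hn); pose i2 : 'I_n := Ordinal hn.
have gframe k : generically (fun z : space R n k => frame_mx i0 i1 i2 z.2 \in unitmx).
  exact: generically_frame.
have gtrans k (j : 'I_k) : generically (fun z : space R n k => transversal (z.1 j) z.2).
  exact: (@generically_transversal _ _ i0 i1).
(* The point at which the cocycle identity and [c] are both well behaved. *)
have [[g x0] z0c [[[near_dc reg_c] x0u] gx0]] := generically_point (generically_and
  (generically_and (generically_and (generically_near dc) (generically_drop_first (cochain_regular cc)))
    (gframe _)) (gtrans _ ord_max)).
rewrite /= in x0u gx0.
(* The slice map sends [z1] to [(g, x0)], because the section at
   [act (g ord_max) x0] is [g ord_max]. *)
pose z1 : space R n m.+1 := act_last (g, x0).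
pose slc k := @slice R n i0 i1 i2 x0 k.
have x1u : frame_mx i0 i1 i2 z1.2 \in unitmx by exact: frame_mx_act_unit.
have s1 : section i0 i1 i2 x0 z1.2 = g ord_max.
  by rewrite section_act // /section mulgV mulg1.
have w1 : slide i0 i1 i2 x0 z1.2 = x0.
  by rewrite /slide s1 -act_mul ?mulVg ?act_1 //; exact: transversal1.
have t1 : transversal (section i0 i1 i2 x0 z1.2)^-1%g z1.2.
  rewrite s1; apply: (transversal_act gx0); rewrite mulVg; exact: transversal1.
have z1c : in_chart z1 by move=> j; exact: z0c.
have slc1 : slc _ z1 = (g, x0).
  rewrite /slc /slice w1 s1; congr pair; apply/esym/eq_snoc => //.
have slc1' : slc _ (drop_first z1) = drop_first (g, x0).
  rewrite /slc /slice /= w1 s1; congr pair; apply/esym/eq_snoc => [j|] /=; congr g; exact/val_inj.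
pose b := c \o slc m.
have c0 : forall z, c z != 0 by case: cc.
have b0 z : b z != 0 by exact: c0.
have z1c' : in_chart (drop_first z1) by move=> j; exact: z1c.
have bc : cochains b.
  apply: (@regular_cochain _ _ _ b (drop_first z1)) => //.
  have chart0 : in_chart (slc _ (drop_first z1)) by rewrite slc1' => j; exact: z0c.
  apply: regular_pullback => //.
  - exact: zariski_near_slice_chart.
  - by move=> k; exact: regular_slice.
  - by rewrite slc1'.
have [b' bc' b'E] := sign_cochain bc; exists b' => //.
have chart1 : in_chart (slc _ z1) by rewrite slc1.
have near_slc : zariski_near z1 (fun z => differential c (slc _ z) = 1).
  apply: (@zariski_near_pullback _ _ _ _ (slc m.+1) z1 z1c _ _ (fun z => differential c z = 1)).
  - exact: zariski_near_slice_chart.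
  - by move=> k; exact: regular_slice.
  - by rewrite slc1.
have near_s := zariski_near_section_transversal x0u x1u z1c t1.
have := generically_and (generically_and (gframe _) (gtrans _ ord_max))
  (zariski_near_generically (zariski_near_and near_slc near_s)).
move/generically_imp; apply => z _ [[zu gz] [dcz sz]].
rewrite b'E; move: dcz; rewrite differentialS bar_product_slice // -/b => E.
have -> : bar_product b z = (c z ^ ((-1) ^+ m.+2 : int))^-1.
  by rewrite -[LHS](mulfK (expfz_neq0 ((-1) ^+ m.+2) (c0 z))) E div1r.
by rewrite (exprS _ m.+1) mulN1r -invr_expz invrK exprz_exp -expr2 sqrr_sign expr1z.
Qed.

End Vanishing.

Section CohomologyClasses.
Variables (R : realType) (n m : nat).
Local Open Scope classical_set_scope.

Lemma coboundariesM (b c : map_space R n m.+1) :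
  coboundaries b -> coboundaries c -> coboundaries (fun z => b z * c z).
Proof.
move=> [bc [b' bc' bE]] [cc [c' cc' cE]]; split; first exact: cochainsM.
exists (fun z => b' z * c' z); first exact: cochainsM.
apply: generically_imp (generically_and bE cE) _ => z _ [-> ->].
by rewrite differentialM.
Qed.

Lemma coboundariesV (c : map_space R n m.+1) :
  coboundaries c -> coboundaries (fun z => (c z)^-1).
Proof.
move=> [cc [c' cc' cE]]; split; first exact: cochainsV.
exists (fun z => (c' z)^-1); first exact: cochainsV.
by apply: generically_imp cE _ => z _ ->; rewrite differentialV.
Qed.

Lemma boundary_coset_cocycle (hn : (3 <= n)%N) (c : map_space R n m.+1) :
  cocycles c -> boundary_coset c = @coboundaries R n m.+1.
Proof.
move=> cZ; have cB : coboundaries c by split; [case: cZ|exact: cocycle_coboundary hn _ _ cZ].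
apply/seteqP; split=> [_ [b bB <-]|b bB]; first exact: coboundariesM.
exists (fun z => (c z)^-1 * b z); first exact: coboundariesM (coboundariesV cB) bB.
by case: cB => -[c0 _] _; apply/funext => z; rewrite mulVKf.
Qed.

Lemma cocycles1 : @cocycles R n m.+1 (fun=> 1).
Proof.
split; first exact: cochains1.
by exists 1; rewrite ?oner_neq0 // => z _ _; rewrite differential1.
Qed.

End CohomologyClasses.

Local Open Scope classical_set_scope.

Theorem mainTheorem5 (R : realType) (n : nat) (hn : (3 <= n)%N)
    (m : nat) (hm : (1 <= m)%N) :
  @cohomology R n m = [set @coboundaries R n m].
Proof.
case: m hm => // m _; apply/seteqP; split=> [_ [c cZ <-]|_ ->].
  exact: boundary_coset_cocycle hn _ cZ.
by exists (fun=> 1); [exact: cocycles1|exact: boundary_coset_cocycle hn _ (cocycles1 R n m)].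
Qed.
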